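(* Let $\mathcal{X}$ be a nonsingular, projective, geometrically irreducible algebraic curve of positive genus over $\mathbb{F}_q$, let $m\geq 2$, and let $\mathbf{Q}=(Q_1,\ldots,Q_m)$ be an $m$-tuple of pairwise distinct rational points on $\mathcal{X}$. Assume that $q\geq m$. Then the set $G_0(\mathbf{Q})$ of pure Weierstrass gaps of $\mathcal{X}$ at $\mathbf{Q}$ satisfies $$G_0(\mathbf{Q})=\bigcup_{(\boldsymbol{\beta}^1,\ldots,\boldsymbol{\beta}^m)\in\Lambda(\mathbf{Q})^m}\left(\bigcap_{i=1}^m \overline{\nabla}_i(\boldsymbol{\beta}^i)\right).$$
   Context: $\mathbb{N}_0$ is the set of nonnegative integers and $I=\{1,\ldots,m\}$. For a divisor $D$, $\ell(D)$ is the $\mathbb{F}_q$-dimension of the Riemann–Roch space $\mathcal{L}(D)$. For $\boldsymbol{\alpha}\in\mathbb{Z}^m$, $D_{\boldsymbol{\alpha}}=\alpha_1Q_1+\cdots+\alpha_mQ_m$. For a rational function $h$, $v_{Q_i}(h)$ is its valuation at $Q_i$ and $\mathrm{div}_\infty(h)$ is its divisor of poles. Gaps and pure gaps: $H(\mathbf{Q})=\{(\alpha_1,\ldots,\alpha_m)\in\mathbb{N}_0^m : \exists\, h\in\mathbb{F}_q(\mathcal{X})^\times \text{ with } \mathrm{div}_\infty(h)=\sum_{i=1}^m\alpha_iQ_i\}$, $G(\mathbf{Q})=\mathbb{N}_0^m\setminus H(\mathbf{Q})$, and $G_0(\mathbf{Q})$ is the set of $\boldsymbol{\alpha}\in G(\mathbf{Q})$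 with $\ell(D_{\boldsymbol{\alpha}})=\ell(D_{\boldsymbol{\alpha}}-Q_j)$ for all $j=1,\ldots,m$. Generalized Weierstrass semigroup: let $R_{\mathbf{Q}}$ be the set of functions in $\mathbb{F}_q(\mathcal{X})$ regular outside $\{Q_1,\ldots,Q_m\}$; then $\widehat{H}(\mathbf{Q})=\{(-v_{Q_1}(h),\ldots,-v_{Q_m}(h))\in\mathbb{Z}^m : h\in R_{\mathbf{Q}}\setminus\{0\}\}$. For $\boldsymbol{\alpha}\in\mathbb{Z}^m$ and a nonempty $J\subsetneq I$: $\overline{\nabla}_J(\boldsymbol{\alpha})=\{\boldsymbol{\beta}\in\mathbb{Z}^m : \beta_j=\alpha_j \text{ for } j\in J \text{ and } \beta_i<\alpha_i \text{ for } i\notin J\}$ and $\nabla_J(\boldsymbol{\alpha})=\overline{\nabla}_J(\boldsymbol{\alpha})\cap\widehat{H}(\mathbf{Q})$. Write $\overline{\nabla}_i=\overline{\nabla}_{\{i\}}$ and $\nabla(\boldsymbol{\alpha})=\bigcup_{i=1}^m\overline{\nabla}_i(\boldsymbol{\alpha})\cap\widehat{H}(\mathbf{Q})$. An element $\boldsymbol{\alpha}\in\widehat{H}(\mathbf{Q})$ is maximal if $\nabla(\boldsymbol{\alpha})=\emptyset$; it is relative maximal if it is maximal and $\nabla_J(\boldsymbol{\alpha})\neq\emptyset$ for every $J\subsetneq I$ with $\#J\geq 2$. $\widehat{\Lambda}(\mathbf{Q})$ denotes the set of relative maximal elements of $\widehat{H}(\mathbf{Q})$, and $\Lambda(\mathbf{Q})=\widehat{\Lambda}(\mathbf{Q})\cap\mathbb{N}_0^m$.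 *)

(* Defs.v *)
From HB Require Import structures.
From mathcomp Require Import all_boot all_order all_algebra.
From mathcomp Require Import boolp classical_sets.
From mathcomp Require Import freeg.

Set Implicit Arguments.
Unset Strict Implicit.
Unset Printing Implicit Defensive.

Import Order.TTheory GRing.Theory Num.Theory.
Local Open Scope ring_scope.
Local Open Scope classical_set_scope.

(* Curves and their points, in the function field language.  A nonsingular
   projective curve over [K] is the abstract nonsingular curve of its function
   field [F / K]: its closed points are the places of [F / K], the local ring
   at a point being the corresponding discrete valuation ring. *)

Definition ratfun_of (K F : fieldType) (k : {rmorphism K -> F}) (x : F) :
    set F :=
  [set z | exists p q : {poly K}, z = (map_poly k p).[x] / (map_poly k q).[x]].

Definition is_function_field (K F : fieldType) (k : {rmorphism K -> F}) :=
  exists x : F,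
    ~ algebraicOver k x /\
    exists (n : nat) (e : 'I_n -> F), forall y : F,
      exists a : 'I_n -> F,
        (forall i, ratfun_of k x (a i)) /\ y = \sum_(i < n) a i * e i.

(* Irreducibility after base change to every finite extension of [K].  As [K]
   is finite, such an extension is [K[t]/(p)] for an irreducible [p], and the
   base change of [F] to it is [F[t]/(p)], which is a domain exactly when [p] is
   irreducible over [F]. *)
Definition geometrically_irreducible (K : finFieldType) (F : fieldType)
    (k : {rmorphism K -> F}) :=
  forall p : {poly K}, irreducible_poly p -> irreducible_poly (map_poly k p).

Record curve (K : finFieldType) := Curve {
  funfield :> fieldType;
  cst : {rmorphism K -> funfield};
  _ : is_function_field cst;
  _ : geometrically_irreducible cst }.

(* Normalized discrete valuations of the function field trivial on constants.
   The value at [0], which should be [+oo], is set to [0]; with this convention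
   a place is determined by its valuation, and every use of [pval P f] below
   either assumes [f != 0] or treats [f = 0] consistently. *)
Record place (K : finFieldType) (X : curve K) := Place {
  pval :> X -> int;
  _ : pval 0 = 0;
  _ : forall f g, f != 0 -> g != 0 -> pval (f * g) = pval f + pval g;
  _ : forall f g, f != 0 -> g != 0 -> f + g != 0 ->
        Num.min (pval f) (pval g) <= pval (f + g);
  _ : forall c : K, pval (cst X c) = 0;
  _ : exists t, pval t = 1 }.

HB.instance Definition _ (K : finFieldType) (X : curve K) :=
  gen_eqMixin (place X).
HB.instance Definition _ (K : finFieldType) (X : curve K) :=
  gen_choiceMixin (place X).

Section Curve.
Variables (K : finFieldType) (X : curve K).

(* [e] is a [K]-basis of [V / W], for [K]-subspaces [W `<=` V] of the function
   field. *)
Definition basis_mod (V W : set X) (n : nat) (e : 'I_n -> X) :=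
  [/\ forall i, V (e i),
      forall c : 'I_n -> K,
        W (\sum_(i < n) cst X (c i) * e i) -> forall i, c i = 0 &
      forall f, V f ->
        exists c : 'I_n -> K, W (f - \sum_(i < n) cst X (c i) * e i)].

(* [dim_K (V / W)], with value [0] if it is infinite. *)
Definition dim_mod (V W : set X) : nat :=
  xget 0%N [set n | exists e : 'I_n -> X, basis_mod V W e].

(* Degree of the residue field over [K]. *)
Definition deg_place (P : place X) : nat :=
  dim_mod [set f | 0 <= P f] [set f | f = 0 \/ 0 < P f].

Definition rational_point (P : place X) := deg_place P = 1%N.

Definition divisor := {freeg (place X) / int}.

Definition deg_div (D : divisor) : int :=
  \sum_(P <- dom D) coeff P D * (deg_place P)%:Z.

Definition RRspace (D : divisor) : set X :=
  [set f | f = 0 \/ forall P : place X, - coeff P D <= P f].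

Definition ell (D : divisor) : nat := dim_mod (RRspace D) [set 0].

(* The genus is the maximum of [deg D - ell D + 1] over all divisors [D]. *)
Definition is_genus (g : nat) :=
  (exists D : divisor, g%:Z = deg_div D - (ell D)%:Z + 1) /\
  (forall D : divisor, deg_div D - (ell D)%:Z + 1 <= g%:Z).

Definition genus : nat := xget 0%N is_genus.

(* [h != 0] has divisor of poles [D]. *)
Definition has_pole_divisor (h : X) (D : divisor) :=
  forall P : place X, coeff P D = Num.max 0 (- P h).

Section Points.
Variables (m : nat) (Q : 'I_m -> place X).

Local Notation "'Zm'" := {ffun 'I_m -> int}.

Definition div_of (a : Zm) : divisor := \sum_(i < m) << a i *g Q i >>.

Definition nneg_tuples : set Zm := [set a | forall i, 0 <= a i].

Definition weierstrass_semigroup : set Zm :=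
  [set a | nneg_tuples a /\
     exists h : X, h != 0 /\ has_pole_divisor h (div_of a)].

Definition gaps : set Zm := nneg_tuples `\` weierstrass_semigroup.

Definition pure_gaps : set Zm :=
  [set a | gaps a /\
     forall j : 'I_m, ell (div_of a) = ell (div_of a - << 1 *g Q j >>)].

Definition regular_outside : set X :=
  [set h | h = 0 \/
     forall P : place X, (forall i, P <> Q i) -> 0 <= P h].

Definition gen_semigroup : set Zm :=
  [set a | exists h : X,
     [/\ regular_outside h, h != 0 & forall i, a i = - Q i h]].

Definition nabla_bar (J : {set 'I_m}) (a : Zm) : set Zm :=
  [set b | (forall j, j \in J -> b j = a j) /\
           (forall i, i \notin J -> b i < a i)].

Definition nabla_sub (J : {set 'I_m}) (a : Zm) : set Zm :=
  nabla_bar J a `&` gen_semigroup.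

Definition nabla (a : Zm) : set Zm :=
  (\bigcup_(i in [set: 'I_m]) nabla_bar [set i]%SET a) `&` gen_semigroup.

Definition maximal_elt (a : Zm) := gen_semigroup a /\ nabla a = set0.

Definition rel_maximal_elts : set Zm :=
  [set a | maximal_elt a /\
     forall J : {set 'I_m}, J \proper [set: 'I_m]%SET -> (2 <= #|J|)%N ->
       nabla_sub J a <> set0].

Definition nneg_rel_maximal_elts : set Zm := rel_maximal_elts `&` nneg_tuples.

End Points.

End Curve.

(* Main.v *)
Require Import Defs.
From mathcomp Require Import freeg.
From mathcomp Require Import all_boot all_order all_algebra.
From mathcomp Require Import zify ring.
From mathcomp Require Import boolp classical_sets.

(* A pure gap [a] is a tuple such that, for every [i], no [h] in [L(D_a)] has
   pole order exactly [a i] at [Q i].  Fix [i] and raise the other coordinates of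
   [a], keeping the property that no function regular outside the [Q j] has pole
   order [a i] at [Q i] and pole orders below the current tuple elsewhere.
   By Riemann's inequality each coordinate is bounded under this property; a
   tuple [b] that cannot be raised further has [nabla_i(b)] empty and every
   [nabla_{i,j}(b)] nonempty, and linear combinations of functions witnessing the
   latter show that [b] is relative maximal; [m <= q] leaves enough
   nonzero coefficients for this.  Conversely, a function in [L(D_a)] of pole
   order exactly [a i] at [Q i] would witness an element of [nabla_i(b^i)]. *)

Set Implicit Arguments.
Unset Strict Implicit.
Unset Printing Implicit Defensive.

Import Order.TTheory GRing.Theory Num.Theory.
Local Open Scope ring_scope.
Local Open Scope classical_set_scope.

(** * Linear algebra: subspaces of the function field and their dimensions *)

Section Subspaces.
Variables (K : finFieldType) (X : curve K).
Implicit Types (V W : set X) (n r : nat).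

Definition subspace V := V 0 /\ forall (c : K) f g, V f -> V g -> V (f + cst X c * g).

Definition free_family n (e : 'I_n -> X) :=
  forall c : 'I_n -> K, \sum_(i < n) cst X (c i) * e i = 0 -> forall i, c i = 0.

(** The coordinate matrix of [u] in [e] has trivial left kernel, so its rank is [r], which is at
    most its number of columns. *)
Lemma free_family_leq V n r (e : 'I_n -> X) (u : 'I_r -> X) :
  basis_mod V [set 0] e -> (forall i, V (u i)) -> free_family u -> (r <= n)%N.
Proof.
move=> [_ _ e_span] uV u_free.
have /choice[a Ea] i : exists c : 'I_n -> K, u i = \sum_(j < n) cst X (c j) * e j.
  by have [c /subr0_eq] := e_span _ (uV i); exists c.
pose A := \matrix_(i < r, j < n) a i j.
suff /eqP <- : row_free A by apply: rank_leq_col.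
apply: inj_row_free => v vA0.
suff u0 : \sum_(i < r) cst X (v 0 i) * u i = 0.
  by apply/rowP => i; rewrite (u_free _ u0 i) mxE.
under eq_bigr do rewrite Ea mulr_sumr.
rewrite exchange_big big1 //= => j _.
have := congr1 (fun w : 'rV_n => cst X (w 0 j) * e j) vA0.
rewrite !mxE rmorph0 mul0r rmorph_sum mulr_suml => vA0j.
rewrite -[RHS]vA0j.
by apply: eq_bigr => i _; rewrite mxE rmorphM mulrA.
Qed.

Lemma free_family_extend n (e : 'I_n -> X) (t : X) : free_family e ->
  ~ (exists c : 'I_n -> K, t = \sum_(i < n) cst X (c i) * e i) ->
  free_family (fun i : 'I_n.+1 => oapp e t (unlift ord_max i)).
Proof.
move=> e_free t_out c; rewrite big_ord_recr /= unlift_none /=.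
have lift_wid (i : 'I_n) : widen_ord (leqnSn n) i = lift ord_max i.
  by apply: val_inj; rewrite /= /bump leqNgt ltn_ord.
under eq_bigr do rewrite lift_wid liftK /=.
case: (eqVneq (c ord_max) 0) => [c0|c_neq0].
  rewrite c0 rmorph0 mul0r addr0 => /e_free ec i.
  by case: (unliftP ord_max i) => [j ->|->].
move=> /eqP; rewrite addrC addr_eq0 => /eqP ct.
case: t_out; exists (fun i => - (c ord_max)^-1 * c (lift ord_max i)).
apply: (@mulfI _ (cst X (c ord_max))); first by rewrite fmorph_eq0.
rewrite ct mulr_sumr -sumrN; apply: eq_bigr => i _.
by rewrite mulrA -rmorphM mulrA mulrN divff // mulN1r rmorphN mulNr.
Qed.

Lemma subspace_sum V (I : finType) (P : pred I) (c : I -> K) (u : I -> X) : subspace V ->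
  (forall i, P i -> V (u i)) -> V (\sum_(i | P i) cst X (c i) * u i).
Proof.
move=> [V0 VD] uV; apply: (big_ind V) => // [f g Vf Vg|i /uV Vi].
  by have := VD 1 f g Vf Vg; rewrite rmorph1 mul1r.
by have := VD (c i) _ _ V0 Vi; rewrite add0r.
Qed.

Lemma subspaceB V f g : subspace V -> V f -> V g -> V (f - g).
Proof.
by move=> [_ VD] Vf /(VD (-1) _ _ Vf); rewrite rmorphN rmorph1 mulN1r.
Qed.

Lemma basis_uniq V n r (e : 'I_n -> X) (u : 'I_r -> X) :
  basis_mod V [set 0] e -> basis_mod V [set 0] u -> n = r.
Proof.
move=> be bu; have [eV ef _] := be; have [uV uf _] := bu.
by apply/eqP; rewrite eqn_leq (free_family_leq be uV uf) (free_family_leq bu eV ef).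
Qed.

Lemma dim_mod_basis V n (e : 'I_n -> X) :
  basis_mod V [set 0] e -> dim_mod V [set 0] = n.
Proof.
move=> be; apply: xget_unique; first by exists e.
by move=> r [u bu]; apply: basis_uniq bu be.
Qed.

(** Free families in [W] have bounded length, and one of maximal length spans [W], since otherwise
    it could be extended. *)
Lemma subspace_basis V W : subspace W -> W `<=` V ->
  (exists n (e : 'I_n -> X), basis_mod V [set 0] e) ->
  exists n (e : 'I_n -> X), basis_mod W [set 0] e.
Proof.
move=> subW WV [n [e be]].
pose P r := `[< exists u : 'I_r -> X, (forall i, W (u i)) /\ free_family u >].
have P0 : exists r, P r.
  by exists 0%N; apply/asboolP; exists (fun=> 0); split=> [[]|? ? []].
have Ple r : P r -> (r <= n)%N.
  move=> /asboolP[u [uW uf]].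
  by apply: free_family_leq be _ uf => i; apply/WV.
have [r /asboolP[u [uW uf]] rmax] := ex_maxnP P0 Ple.
exists r, u; split=> // f Wf.
case: (pselect (exists c : 'I_r -> K, f = \sum_(i < r) cst X (c i) * u i)) => [[c ->]|f_out].
  by exists c; rewrite /= subrr.
suff /rmax : P r.+1 by rewrite ltnn.
apply/asboolP; exists (fun i => oapp u f (unlift ord_max i)).
by split=> [i|]; [case: unlift | apply: free_family_extend].
Qed.

Lemma basis_extend V W n (e : 'I_n -> X) (t : X) : subspace V -> subspace W -> W `<=` V ->
  V t -> ~ W t -> (forall f, V f -> exists c : K, W (f - cst X c * t)) ->
  basis_mod W [set 0] e -> exists u : 'I_n.+1 -> X, basis_mod V [set 0] u.
Proof.
move=> subV subW WV Vt Wt V_W [eW ef es].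
exists (fun i => oapp e t (unlift ord_max i)); split.
- by move=> i; case: unlift => //= j; apply: WV.
- apply: free_family_extend => // -[c tE]; apply: Wt; rewrite tE.
  exact: subspace_sum.
move=> f /V_W [a /es [c /subr0_eq fE]].
exists (fun i => oapp c a (unlift ord_max i)).
rewrite big_ord_recr /= unlift_none /=.
under eq_bigr => i _.
  have -> : widen_ord (leqnSn n) i = lift ord_max i.
    by apply: val_inj; rewrite /= /bump leqNgt ltn_ord.
  rewrite liftK /=; over.
by rewrite -fE subrK subrr.
Qed.

Lemma dim_mod0 : dim_mod ([set 0] : set X) [set 0] = 0%N.
Proof.
apply: (@dim_mod_basis _ 0%N (fun=> 0)); split=> [[]//|? ? []//|f ->].
by exists (fun=> 0); rewrite big_ord0 subrr.
Qed.

End Subspaces.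

(** * Valuations: orders of sums, and leading coefficients at rational points *)

Section Valuations.
Variables (K : finFieldType) (X : curve K).
Implicit Types (P : place X) (f g : X) (n : int).

(* The condition [v_P(f) >= n], where [v_P(0)] is [+oo]. *)
Definition val_ge P n : set X := [set f | f = 0 \/ n <= P f].

Lemma pvalM P f g : f != 0 -> g != 0 -> P (f * g) = P f + P g.
Proof. by case: P => ? ? H *; apply: H. Qed.

Lemma pval_cst P (c : K) : P (cst X c) = 0.
Proof. by case: P => ? ? ? ? H *; apply: H. Qed.

Lemma pval1 P : P 1 = 0.
Proof. by rewrite -(rmorph1 (cst X)) pval_cst. Qed.

Lemma val_geE P n f : f != 0 -> val_ge P n f = (n <= P f) :> Prop.
Proof.
move=> /eqP f0; apply/propext; split=> [[]//|]; by right.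
Qed.

Lemma val_ge_mul P n k f g :
  val_ge P n f -> val_ge P k g -> val_ge P (n + k) (f * g).
Proof.
move=> [->|nf]; first by left; rewrite mul0r.
move=> [->|kg]; first by left; rewrite mulr0.
have [->|f0] := eqVneq f 0; first by left; rewrite mul0r.
have [->|g0] := eqVneq g 0; first by left; rewrite mulr0.
by right; rewrite pvalM // lerD.
Qed.

Lemma val_ge_leq P n k f : k <= n -> val_ge P n f -> val_ge P k f.
Proof. by move=> kn [->|nf]; [left | right; apply: le_trans nf]. Qed.

Lemma val_geD P n f g : val_ge P n f -> val_ge P n g -> val_ge P n (f + g).
Proof.
move=> nf ng.
have [->|f0] := eqVneq f 0; first by rewrite add0r.
have [->|g0] := eqVneq g 0; first by rewrite addr0.
have [|fg0] := eqVneq (f + g) 0; first by left.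
move: nf ng; rewrite !val_geE // => nf ng.
by case: P nf ng => v ? ? H ? ? /= nf ng; apply: le_trans (H _ _ f0 g0 fg0); rewrite le_min nf.
Qed.

Lemma val_ge_cst P n (c : K) f : val_ge P n f -> val_ge P n (cst X c * f).
Proof.
move=> nf; rewrite -[n]add0r; apply: val_ge_mul => //.
by right; rewrite pval_cst.
Qed.

Lemma val_ge_subspace P n : subspace (val_ge P n).
Proof.
split; first by left.
by move=> c f g nf ng; apply: val_geD => //; apply: val_ge_cst.
Qed.

Lemma pval_exact P n f : f != 0 -> P f = n <-> val_ge P n f /\ ~ val_ge P (n + 1) f.
Proof.
move=> f0; rewrite !val_geE //; split=> [->|[]]; last by lia.
by split; lia.
Qed.

(** If [f + g] had larger order, so would [f = (f + g) - g]. Nonvanishing is recorded as well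
    because [pval] at 0 is only a default. *)
Lemma pval_addl P f g : f != 0 -> val_ge P (P f + 1) g -> f + g != 0 /\ P (f + g) = P f.
Proof.
move=> f0 gf; have hi : ~ val_ge P (P f + 1) (f + g).
  move=> /(fun h => subspaceB (val_ge_subspace P _) h gf).
  by rewrite addrK val_geE //; lia.
have fg0 : f + g != 0 by apply/eqP => fg0; apply: hi; left.
split=> //; apply/pval_exact => //; split=> //; apply: val_geD; first by right.
by apply: val_ge_leq gf; lia.
Qed.

Lemma residue P f : rational_point P -> val_ge P 0 f ->
  exists c : K, val_ge P 1 (f - cst X c).
Proof.
(* Degree 1 is not the default value 0 of [dim_mod], so a basis of the residue field exists. *)
move=> ratP Pf; have [e [_ _ eS]] : exists e : 'I_1 -> X,
    basis_mod [set f | 0 <= P f] [set f | f = 0 \/ 0 < P f] e.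
  by move: ratP; rewrite /rational_point /deg_place /dim_mod; case: xgetP => // n _ + <-.
have val1 g : (g = 0 \/ 0 < P g) -> val_ge P 1 g by case; [left|right; lia].
have sp c g : g - \sum_(i < 1) cst X (c i) * e i = g - cst X (c ord0) * e ord0.
  by rewrite big_ord1.
have P1 : 0 <= P 1 by rewrite pval1.
(* Modulo the maximal ideal, [1] and [f] are constant multiples of the same basis vector; the
   quotient of their coordinates is the residue of [f]. *)
have [c /val1] := eS _ P1; rewrite {}sp => ce.
have c0 : c ord0 != 0.
  apply/eqP => c0; move: ce; rewrite c0 rmorph0 mul0r subr0 val_geE ?oner_eq0 // pval1 //.
case: Pf => [->|P_f]; first by exists 0; left; rewrite rmorph0 subr0.
have [d /val1] := eS _ P_f; rewrite big_ord1 => de.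
exists (d ord0 / c ord0).
have [_ /(_ (- (d ord0 / c ord0)) _ _ de ce)] := val_ge_subspace P 1.
congr (val_ge P 1 _); rewrite rmorphN rmorphM fmorphV; field.
by rewrite fmorph_eq0.
Qed.

(** The constant is the residue of [g / f]; multiplying back by [f] shifts the order by [P f]. *)
Lemma leading_coeff P f g : rational_point P -> f != 0 -> val_ge P (P f) g ->
  exists c : K, val_ge P (P f + 1) (g - cst X c * f).
Proof.
move=> ratP f0 gf.
have Vf : P f^-1 = - P f.
  by have := pvalM P f0 (invr_neq0 f0); rewrite divff // pval1; lia.
have : val_ge P 0 (g / f).
  rewrite -(subrr (P f)); apply: val_ge_mul => //; right; by rewrite Vf.
move=> /(residue ratP) [c /val_ge_mul mulc]; exists c.
have := mulc (P f) f; rewrite addrC mulrBl divfK //; apply.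
by right.
Qed.

End Valuations.

(** * Divisors supported on the points [Q i] and their Riemann-Roch spaces *)

Section Divisors.
Variables (K : finFieldType) (X : curve K) (m : nat) (Q : 'I_m -> place X).
Hypothesis Q_inj : injective Q.
Implicit Types (a b : {ffun 'I_m -> int}) (f g : X) (P : place X).

Definition set_at a j (x : int) : {ffun 'I_m -> int} :=
  [ffun k => if k == j then x else a k].

Lemma set_at_eq a j x : set_at a j x j = x.
Proof. by rewrite ffunE eqxx. Qed.

Lemma set_at_neq a j x k : k != j -> set_at a j x k = a k.
Proof. by rewrite ffunE => /negPf ->. Qed.

Lemma sum_set_at a j x : \sum_(k < m) set_at a j x k = \sum_(k < m) a k - a j + x.
Proof.
rewrite (bigD1 j) //= set_at_eq [in RHS](bigD1 j) //= addrC [a j + _]addrC addrK.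
by congr (_ + _); apply: eq_bigr => k kj; rewrite set_at_neq.
Qed.

Lemma coeff_div_of a i : coeff (Q i) (div_of Q a) = a i.
Proof.
rewrite raddf_sum (bigD1 i) //= coeffU eqxx mulr1 big1 ?addr0 // => k /negPf ki.
by rewrite coeffU (inj_eq Q_inj) ki mulr0.
Qed.

Lemma coeff_div_of_out a P : (forall i, P <> Q i) -> coeff P (div_of Q a) = 0.
Proof.
move=> PQ; rewrite raddf_sum big1 //= => k _; rewrite coeffU.
by case: eqP => [/esym/PQ//|]; rewrite mulr0.
Qed.

Lemma div_of_sub a j : div_of Q a - << 1 *g Q j >> = div_of Q (set_at a j (a j - 1)).
Proof.
apply/eqP/freeg_eqP => P; rewrite coeffB coeffU mul1r.
case: (pselect (exists i, P = Q i)) => [[i ->]|PQ].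
  rewrite !coeff_div_of ffunE (inj_eq Q_inj) eq_sym.
  by case: eqP => [->|]; rewrite ?subr0.
have {}PQ i : P <> Q i by move=> PQi; apply: PQ; exists i.
rewrite !coeff_div_of_out //; case: eqP => [/esym/PQ//|]; by rewrite subr0.
Qed.

Lemma deg_div_of a : (forall i, rational_point (Q i)) ->
  deg_div (div_of Q a) = \sum_(i < m) a i.
Proof.
move=> Q_rat; rewrite /deg_div; set D := div_of Q a.
(* The support of [D] omits each [Q i] with [a i = 0]; the filter accounts for this, and is dropped
   below because the missing coefficients vanish. *)
have D_perm : perm_eq (dom D) [seq P <- codom Q | P \in dom D].
  apply: uniq_perm; rewrite ?filter_uniq ?uniq_dom //.
    by rewrite map_inj_uniq ?enum_uniq.
  move=> P; rewrite mem_filter; case PD : (P \in dom D) => //=.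
  apply/esym; case: (pselect (exists i, P = Q i)) => [[i ->]|PQ].
    exact: codom_f.
  move: PD; rewrite mem_dom coeff_div_of_out ?eqxx // => i PQi.
  by apply: PQ; exists i.
rewrite (perm_big _ D_perm) big_filter big_rmcond.
  rewrite big_map big_enum; apply: eq_bigr => i _.
  by rewrite coeff_div_of Q_rat mulr1.
by move=> P PD; rewrite coeff_outdom // mul0r.
Qed.

Lemma regular_outsideE f :
  regular_outside Q f <-> forall P, (forall i, P <> Q i) -> val_ge P 0 f.
Proof.
split=> [[->|f_reg] P PQ|f_reg]; [by left | by right; apply: f_reg |].
by have [->|f0] := eqVneq f 0; [left | right => P /f_reg; rewrite val_geE].
Qed.

Lemma RRspaceE a f : RRspace (div_of Q a) f <->
  regular_outside Q f /\ forall i, val_ge (Q i) (- a i) f.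
Proof.
rewrite regular_outsideE; split=> [[->|fa]|[f_reg fa]].
- by split=> [P _|i]; left.
- split=> [P PQ|i]; right.
    by have := fa P; rewrite coeff_div_of_out // oppr0.
  by have := fa (Q i); rewrite coeff_div_of.
have [->|f0] := eqVneq f 0; [by left | right=> P].
case: (pselect (exists i, P = Q i)) => [[i ->]|PQ].
  by have := fa i; rewrite val_geE // coeff_div_of.
have {}PQ i : P <> Q i by move=> PQi; apply: PQ; exists i.
by have := f_reg P PQ; rewrite val_geE // coeff_div_of_out.
Qed.

Lemma regular_outside_subspace : subspace (regular_outside Q).
Proof.
split=> [|c f g]; first by left.
rewrite !regular_outsideE => fP gP P PQ.
by have [_] := val_ge_subspace P 0; apply; [apply: fP | apply: gP].
Qed.

Lemma regular_outsideM f g :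
  regular_outside Q f -> regular_outside Q g -> regular_outside Q (f * g).
Proof.
rewrite !regular_outsideE => fP gP P PQ; rewrite -[0]addr0.
by apply: val_ge_mul; [apply: fP | apply: gP].
Qed.

Lemma RRspace_subspace a : subspace (RRspace (div_of Q a)).
Proof.
have [R0 RD] := regular_outside_subspace; split=> [|c f g]; first by left.
rewrite !RRspaceE => -[fR fa] [gR ga]; split=> [|i]; first exact: RD.
by have [_] := val_ge_subspace (Q i) (- a i); apply.
Qed.

Lemma RRspace_sub a b : (forall i, a i <= b i) ->
  RRspace (div_of Q a) `<=` RRspace (div_of Q b).
Proof.
move=> ab f /RRspaceE[fR fa]; apply/RRspaceE; split=> // i.
by apply: val_ge_leq (fa i); rewrite lerN2.
Qed.

(** This dichotomy translates between equality of the two spaces and absence of functions of pole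
    order exactly [a j] at [Q j]. *)
Lemma RRspace_exact a j f : RRspace (div_of Q a) f ->
  RRspace (div_of Q (set_at a j (a j - 1))) f \/ f != 0 /\ Q j f = - a j.
Proof.
move=> /RRspaceE[fR fa].
have [->|f0] := eqVneq f 0; first by left; left.
have := fa j; rewrite val_geE // => fj.
have [fj_eq|/eqP fj_neq] := eqVneq (Q j f) (- a j); [by right | left].
apply/RRspaceE; split=> // i; rewrite ffunE; case: eqVneq => // ->.
by rewrite val_geE //; lia.
Qed.

Lemma RRspace_not_exact a j f : f != 0 -> Q j f = - a j ->
  ~ RRspace (div_of Q (set_at a j (a j - 1))) f.
Proof.
move=> f0 fj /RRspaceE[_ /(_ j)]; rewrite set_at_eq val_geE //; lia.
Qed.

End Divisors.

(** * Riemann's inequality and functions with prescribed poles *)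

Section Riemann.
Variables (K : finFieldType) (X : curve K) (m : nat) (Q : 'I_m -> place X).
Hypotheses (genus_gt0 : (0 < genus X)%N) (Q_inj : injective Q)
  (Q_rat : forall i, rational_point (Q i)).
Implicit Types (a b : {ffun 'I_m -> int}) (f g : X).

(* A positive [genus X] is not the junk value of [xget], so the maximum
   defining it exists: this is Riemann's inequality. *)
Lemma riemann (D : divisor X) : deg_div D - (ell D)%:Z + 1 <= (genus X)%:Z.
Proof.
by move: genus_gt0; rewrite /genus; case: xgetP => // g _ [_ +] _; apply.
Qed.

(* If [L(D)] had no finite basis then neither would [L(D + N Q_j)], whose [ell]
   would be the default value 0; for large [N] this violates Riemann's inequality. *)
Lemma RRspace_basis (j : 'I_m) a :
  exists n (e : 'I_n -> X), basis_mod (RRspace (div_of Q a)) [set 0] e.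
Proof.
(* The degree of [b] is at least the genus, so [ell = 0] would contradict Riemann's inequality
   because of its term [+ 1]. *)
pose b := set_at a j (a j + `|(genus X)%:Z - \sum_(i < m) a i|).
have : exists n (e : 'I_n -> X), basis_mod (RRspace (div_of Q b)) [set 0] e.
  apply: contrapT => no_basis; have := riemann (div_of Q b).
  rewrite /ell /dim_mod xgetPN => [|n [e be]]; last by apply: no_basis; exists n, e.
  by rewrite deg_div_of // sum_set_at; lia.
apply: subspace_basis; first exact: RRspace_subspace.
apply: RRspace_sub => // i; rewrite ffunE; case: eqVneq => // ->; lia.
Qed.

(** Since [Q j] is rational, subtracting a constant multiple of [f] lowers the pole order at [Q j];
    hence the smaller space has codimension one. *)
Lemma ell_step j a f : RRspace (div_of Q a) f -> f != 0 -> Q j f = - a j ->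
  ell (div_of Q a) = (ell (div_of Q (set_at a j (a j - 1)))).+1.
Proof.
move=> fa f0 fj; set b := set_at _ _ _; have [n [e be]] := RRspace_basis j b.
have [||u bu] := basis_extend (RRspace_subspace Q_inj a) (RRspace_subspace Q_inj b)
  _ fa (RRspace_not_exact Q_inj f0 fj) _ be.
- by apply: RRspace_sub => // i; rewrite ffunE; case: eqVneq => // ->; lia.
- move=> g ga; have /(RRspaceE Q_inj)[gR g_ge] := ga.
  have [|c gc] := leading_coeff (g := g) (Q_rat j) f0; first by rewrite fj.
  exists c; have [_ RD] := RRspace_subspace Q_inj a.
  have ga' : RRspace (div_of Q a) (g - cst X c * f).
    by have := RD (- c) _ _ ga fa; rewrite rmorphN mulNr.
  case: (RRspace_exact Q_inj j ga') => // -[h0 hj].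
  by move: gc; rewrite val_geE // hj fj; lia.
by rewrite /ell (dim_mod_basis bu) (dim_mod_basis be).
Qed.

Lemma RRspace_nonzero a : (genus X)%:Z <= \sum_(i < m) a i ->
  exists2 f, RRspace (div_of Q a) f & f != 0.
Proof.
move=> ga; apply: contrapT => no_f; have := riemann (div_of Q a).
rewrite deg_div_of // /ell (_ : RRspace _ = [set 0]) ?dim_mod0; first by lia.
apply/seteqP; split=> f; last by move=> ->; left.
by move=> fa; apply: contrapT => /eqP f0; apply: no_f; exists f.
Qed.

(* The Weierstrass semigroup at [Q_i] is cofinite: each gap increases the
   deficiency [n - ell (n Q_i)], which is nondecreasing and bounded by the genus. *)
Lemma one_point_cofinite i : exists n0 : int, forall n : int, n0 <= n ->
  exists f, [/\ regular_outside Q f, f != 0, Q i f = - n &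
    forall k, k != i -> 0 <= Q k f].
Proof.
pose mult (n : int) := set_at 0 i n.
pose defi (n : int) : int := n - (ell (div_of Q (mult n)))%:Z.
have defi_bound (n : int) : defi n <= (genus X)%:Z.
  have := riemann (div_of Q (mult n)); rewrite deg_div_of // sum_set_at ffunE subr0.
  rewrite big1 => [|k _]; last by rewrite ffunE.
  by rewrite /defi; lia.
have mult1 n : set_at (mult n) i (mult n i - 1) = mult (n - 1).
  by apply/ffunP => k; rewrite /mult !ffunE eqxx; case: eqP.
pose gap (n : int) := forall f, RRspace (div_of Q (mult n)) f ->
  RRspace (div_of Q (mult (n - 1))) f.
have defi_gap n : gap n -> defi n = defi (n - 1) + 1.
  move=> n_gap; suff -> : defi n = n - (ell (div_of Q (mult (n - 1))))%:Z.
    by rewrite /defi; lia.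
  rewrite /defi /ell; congr (_ - (dim_mod _ _)%:Z); apply/seteqP; split=> //.
  by apply: RRspace_sub => // k; rewrite !ffunE; case: eqP => // _; lia.
have defi_nongap n : ~ gap n -> exists f, [/\ regular_outside Q f, f != 0,
    Q i f = - n & forall k, k != i -> 0 <= Q k f].
  move=> not_gap; apply: contrapT => no_f; apply: not_gap => f fn.
  have [|[f0 fi]] := RRspace_exact Q_inj i fn; first by rewrite mult1.
  case: no_f; exists f; have /(RRspaceE Q_inj)[fR fk] := fn; split=> //.
    by rewrite fi set_at_eq.
  by move=> k ki; have := fk k; rewrite set_at_neq // ffunE oppr0 val_geE.
(* At a gap the deficiency grows by one; otherwise [ell] grows along with [n] by [ell_step], and the
   deficiency is unchanged. *)
have defi_mono (n : int) : defi (n - 1) <= defi n.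
  case: (pselect (gap n)) => [/defi_gap ->|/defi_nongap[f [fR f0 fi fk]]].
    by rewrite lerDl.
  have fn : RRspace (div_of Q (mult n)) f.
    apply/RRspaceE => //; split=> // k; rewrite val_geE //.
    by have [->|ki] := eqVneq k i; rewrite ?set_at_eq ?fi // set_at_neq // ffunE fk.
  have := @ell_step i (mult n) f fn f0; rewrite mult1 set_at_eq fi => /(_ erefl).
  by rewrite /defi => ->; move: (ell _) => l; lia.
have defi_le (n k : int) : n <= k -> defi n <= defi k.
  move=> nk; have -> : k = n + `|k - n|%N by lia.
  elim: `|k - n|%N => [|d IH]; first by rewrite addr0.
  by apply: le_trans IH _; have := defi_mono (n + d.+1); congr (defi _ <= _); lia.
(* Without a threshold there would be arbitrarily large gaps, and the deficiency would exceed the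
   genus. *)
apply: contrapT => no_n0.
have gaps_inf (n0 : int) : exists2 n, n0 <= n & gap n.
  apply: contrapT => no_gap; apply: no_n0; exists n0 => n n0n.
  by apply: defi_nongap => n_gap; apply: no_gap; exists n.
have defi_unbounded (d : nat) : exists n, defi 0 + d%:Z <= defi n.
  elim: d => [|d [n IH]]; first by exists 0; rewrite addr0.
  have [k nk /defi_gap kE] := gaps_inf (n + 1); exists k; rewrite kE.
  have := defi_le n (k - 1); lia.
have [n] := defi_unbounded (absz ((genus X)%:Z - defi 0 + 1)).
by have := defi_bound n; lia.
Qed.

(* A factor of large degree, with poles of arbitrary order allowed at [Q_j],
   reduces an arbitrary pole order at [Q_i] to the one-point case. *)
Lemma exact_pole a i j : i != j -> exists h, [/\ regular_outside Q h, h != 0,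
  Q i h = - a i & forall k, k != i -> k != j -> - a k <= Q k h].
Proof.
move=> ij; have [n0 n0P] := one_point_cofinite i.
(* This coordinate forces a zero of [f] at [Q i] of order at least [n0 - a i], so the pole order
   [Q i f + a i] required of the second factor is at least [n0]. Coordinate [j] is then raised until
   the degree reaches the genus. *)
pose b := set_at a i (- `|n0 - a i|).
pose c := set_at b j (b j + `|(genus X)%:Z - \sum_(k < m) b k|).
have c_deg : (genus X)%:Z <= \sum_(k < m) c k.
  by rewrite sum_set_at; lia.
have [f /(RRspaceE Q_inj)[fR fc] f0] := RRspace_nonzero c_deg.
have fi : `|n0 - a i| <= Q i f.
  by have := fc i; rewrite val_geE // set_at_neq // set_at_eq; lia.
have [|g [gR g0 gi gk]] := n0P (Q i f + a i); first by lia.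
exists (f * g); split=> [|||k ki kj].
- exact: regular_outsideM.
- by rewrite mulf_neq0.
- by rewrite pvalM // gi; lia.
rewrite pvalM //; have := fc k; have := gk k ki.
rewrite val_geE // set_at_neq // set_at_neq //; lia.
Qed.

End Riemann.

(** A single nonzero coefficient cannot sum to 0, and over the field with two elements the sum is
    determined by the number of terms; the hypotheses exclude these cases. *)
Lemma nonzero_sum (K : finFieldType) (I : finType) (A : {set I}) (t : K) :
  (0 < #|A|)%N -> t != 0 \/ (1 < #|A|)%N -> (#|A| <= 1)%N \/ (2 < #|K|)%N ->
  exists c : I -> K, (forall k, k \in A -> c k != 0) /\ \sum_(k in A) c k = t.
Proof.
elim: {A}_.+1 {-2}A t (ltnSn #|A|) => // n IH A t An A_gt0 tA KA.
have [x xA] := card_gt0P A_gt0; have Ax := cardsD1 x A; rewrite xA in Ax.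
have [Ax0|Ax_gt0] := posnP #|A :\ x|.
  have t0 : t != 0 by case: tA => //; rewrite Ax Ax0.
  exists (fun=> t); split=> //; rewrite (big_setD1 x) //=.
  by rewrite (cards0_eq Ax0) big_set0 addr0.
have {KA} K2 : (2 < #|K|)%N by case: KA => //; lia.
(* Choosing [s] different from 0 and [t] keeps the remaining sum [t - s] nonzero for the
   induction. *)
have [s] : exists s : K, s \in ~: [set 0; t].
  apply/card_gt0P; rewrite cardsCs finset.setCK subn_gt0.
  by apply: leq_ltn_trans K2; rewrite cards2; case: eqP.
rewrite !inE negb_or => /andP[s0 st].
have [||||c [c0 ct]] := IH (A :\ x) (t - s); rewrite ?subr_eq0 //; first by lia.
- by left; rewrite eq_sym.
- by right.
exists (fun k => if k == x then s else c k); split=> [k kA|].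
  by have [_|kx] := eqVneq k x; last by apply: c0; rewrite !inE kx.
rewrite (big_setD1 x) //= eqxx -[RHS](subrKC s) -ct; congr (_ + _).
by apply: eq_bigr => k; rewrite !inE => /andP[/negPf ->].
Qed.

(** * Relative maximal elements: a criterion and an existence result *)

Section Maximal.
Variables (K : finFieldType) (X : curve K) (m : nat) (Q : 'I_m -> place X).
Hypotheses (Q_inj : injective Q) (Q_rat : forall i, rational_point (Q i)).
Implicit Types (a b : {ffun 'I_m -> int}) (J : {set 'I_m}) (f g h : X).

(** These functions witness elements of [nabla_sub]; unlike tuples of pole orders, they can be
    combined linearly. *)
Definition nabla_fun J b h := [/\ h != 0, regular_outside Q h,
  forall k, k \in J -> Q k h = - b k & forall k, k \notin J -> - b k < Q k h].

Lemma nabla_fun_mem J b h : nabla_fun J b h ->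
  nabla_sub Q J b [ffun k => - Q k h].
Proof.
move=> [h0 hR hJ hJC]; split; last by exists h; split=> // k; rewrite ffunE.
split=> k kJ; rewrite ffunE; first by rewrite hJ // opprK.
by have := hJC k kJ; lia.
Qed.

Lemma mem_nabla_fun J b c : nabla_bar J b c -> gen_semigroup Q c ->
  exists h, nabla_fun J b h.
Proof.
move=> [cJ cJC] [h [hR h0 hc]]; exists h; split=> // k kJ.
  by have := cJ k kJ; have := hc k; lia.
by have := cJC k kJ; have := hc k; lia.
Qed.

Lemma nabla_fun_cst J b h (c : K) : c != 0 ->
  nabla_fun J b h -> nabla_fun J b (cst X c * h).
Proof.
move=> c0 [h0 hR hJ hJC].
have cX0 : cst X c != 0 by rewrite fmorph_eq0.
have vE k : Q k (cst X c * h) = Q k h by rewrite pvalM // pval_cst add0r.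
split=> [||k|k]; rewrite ?vE ?mulf_neq0 //; [|exact: hJ|exact: hJC].
have [R0 RD] := regular_outside_subspace Q.
by have := RD c _ _ R0 hR; rewrite add0r.
Qed.

Lemma nabla_fun_gt J b h k : nabla_fun J b h -> k \notin J ->
  val_ge (Q k) (- b k + 1) h.
Proof. by move=> [_ _ _ hJC] /hJC ?; right; lia. Qed.

Section Criterion.
Variables (b : {ffun 'I_m -> int}) (i : 'I_m).
Hypothesis nabla_i_empty : forall h, ~ nabla_fun [set i] b h.
Hypothesis nabla_ij_nonempty :
  forall j, j != i -> exists h, nabla_fun [set i; j] b h.

(* Cancelling the leading terms at [Q_k] of functions in [nabla_k] and
   [nabla_{i,k}] would give one in [nabla_i]. *)
Lemma nabla_single_empty k h : ~ nabla_fun [set k] b h.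
Proof.
have [->|ki] := eqVneq k i; first exact: nabla_i_empty.
move=> hk; have [g gk] := nabla_ij_nonempty ki.
have [h0 hR hkk _] := hk; have [g0 gR gik _] := gk.
have [|c gc] := leading_coeff (g := g) (Q_rat k) h0.
  by right; rewrite hkk ?gik ?inE ?eqxx ?orbT.
have {}gc : val_ge (Q k) (- b k + 1) (g - cst X c * h) by rewrite hkk ?inE in gc.
(* At [Q i] the pole order of [h] is below [b i], so the subtraction preserves that of [g]. *)
have hi : val_ge (Q i) (Q i g + 1) (- (cst X c * h)).
  rewrite gik ?inE ?eqxx // -mulNr -rmorphN; apply: val_ge_cst.
  by apply: nabla_fun_gt hk _; rewrite inE eq_sym.
have [F0 Fi] := pval_addl g0 hi.
apply: (@nabla_i_empty (g - cst X c * h)); split=> // [|l|l].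
- have [_ RD] := regular_outside_subspace Q.
  by rewrite -mulNr -rmorphN; apply: RD.
- by rewrite inE => /eqP ->; rewrite Fi gik ?inE ?eqxx.
rewrite inE => li; suff : val_ge (Q l) (- b l + 1) (g - cst X c * h).
  by rewrite val_geE //; lia.
have [->//|lk] := eqVneq l k.
apply: (subspaceB (val_ge_subspace (Q l) _)).
  by apply: nabla_fun_gt gk _; rewrite !inE negb_or li.
by apply: val_ge_cst; apply: nabla_fun_gt hk _; rewrite inE.
Qed.

(* Normalize functions [H_j] in [nabla_{i,j}] to have the same leading
   coefficient at [Q_i]; a combination with nonzero coefficients over
   [J :\ i] lies in [nabla_J] as soon as its coefficients sum to a nonzero
   value when [i \in J], and to zero otherwise. *)
Lemma nabla_nonempty J : (m <= #|K|)%N -> (2 <= #|J|)%N ->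
  exists h, nabla_fun J b h.
Proof.
move=> mK J2; have Ji := cardsD1 i J; set A := J :\ i in Ji.
have A_gt0 : (0 < #|A|)%N by move: Ji J2; case: (i \in J) => /= ->; rewrite ?add1n // => /ltnW.
have A_gt1 : (i \in J) || (1 < #|A|)%N by move: Ji J2; case: (i \in J) => //= ->.
have [j0 /setD1P[j0i _]] := card_gt0P A_gt0.
(* The function [u] fixes the common leading coefficient at [Q i]. *)
have [u uj0] := nabla_ij_nonempty j0i; have [u0 uR ui _] := uj0.
have {}ui : Q i u = - b i by rewrite ui // !inE eqxx.
have /choice[H HP] j : exists h, j != i ->
    nabla_fun [set i; j] b h /\ val_ge (Q i) (- b i + 1) (u - h).
  have [->|ji] := eqVneq j i; first by exists 0.
  have [h hj] := nabla_ij_nonempty ji; have [h0 hR hij _] := hj.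
  have hi : Q i h = - b i by rewrite hij // !inE eqxx.
  have [|c uc] := leading_coeff (g := u) (Q_rat i) h0; first by right; rewrite hi ui.
  exists (cst X c * h) => _; rewrite hi in uc; split=> //; apply: nabla_fun_cst => //.
  apply/eqP => c0; move: uc; rewrite c0 rmorph0 mul0r subr0 val_geE // ui; lia.
pose t : K := (i \in J)%:R.
have [||c [c0 ct]] := @nonzero_sum K _ A t A_gt0.
- by rewrite /t; case: (i \in J) A_gt1 => /= ?; [left; rewrite oner_eq0 | right].
(* As [A] omits [i], it has at most [m - 1] elements: if it has two or more, then [m], and hence the
   cardinality of [K], is at least 3. *)
- have : (#|A| <= #|~: [set i]|)%N.
    by apply: subset_leq_card; apply/fintype.subsetP => k; rewrite !inE => /andP[].
  by rewrite cardsC1 card_ord; lia.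
have AiP j : j \in A -> j != i by rewrite !inE => /andP[].
pose S := \sum_(j in A) cst X (c j) * H j.
(* At [Q k] with [k] in [A], only the term [j = k] reaches pole order [b k], so nothing can cancel
   it. *)
have S_gt k : k != i -> val_ge (Q k) (- b k + 1) (\sum_(j in A | j != k) cst X (c j) * H j).
  move=> ki; apply: subspace_sum (val_ge_subspace _ _) _ => j /andP[/AiP/HP[Hj _] jk].
  by apply: nabla_fun_gt Hj _; rewrite !inE negb_or ki eq_sym.
have S_A k : k \in A -> S != 0 /\ Q k S = - b k.
  move=> kA; have [Hk _] := HP k (AiP k kA).
  have [Hk0 _ Hkk _] := nabla_fun_cst (c0 k kA) Hk.
  have {}Hkk : Q k (cst X (c k) * H k) = - b k by rewrite Hkk // !inE eqxx orbT.
  by rewrite /S (bigD1 k) //= -Hkk; apply: pval_addl => //; rewrite Hkk; apply/S_gt/AiP.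
have S0 : S != 0 by have [j /S_A[]] := card_gt0P A_gt0.
have S_i : val_ge (Q i) (- b i + 1) (cst X t * u - S).
  rewrite -ct rmorph_sum mulr_suml -sumrB.
  under eq_bigr do rewrite -mulrBr.
  by apply: subspace_sum (val_ge_subspace _ _) _ => j /AiP/HP[].
exists S; split=> // [|k kJ|k kJ].
- apply: subspace_sum (regular_outside_subspace Q) _ => j /AiP/HP[[]] //.
- have [ki|ki] := eqVneq k i; last by apply: (S_A k _).2; rewrite !inE ki.
  subst k; rewrite /t kJ rmorph1 mul1r in S_i.
  have /(pval_addl u0)[_] : val_ge (Q i) (Q i u + 1) (S - u).
    by have := val_ge_cst (-1) S_i; rewrite rmorphN rmorph1 mulN1r opprB ui.
  by rewrite subrKC ui.
have [ki|ki] := eqVneq k i.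
  subst k; move: S_i; rewrite /t (negPf kJ) rmorph0 mul0r sub0r.
  move=> /(val_ge_cst (-1)); rewrite rmorphN rmorph1 mulrNN mul1r val_geE //; lia.
have kA : k \notin A by rewrite !inE (negPf kJ) andbF.
have := S_gt k ki; rewrite (_ : \sum_(j in A | j != k) _ = S).
  by rewrite val_geE //; lia.
by apply: eq_bigl => j; case: eqVneq => [->|]; rewrite ?(negPf kA) ?andbT.
Qed.

Lemma rel_maximal_criterion : (2 <= m <= #|K|)%N -> rel_maximal_elts Q b.
Proof.
move=> /andP[m2 mK]; split; last first.
  move=> J _ J2 J0; have [h /nabla_fun_mem] := nabla_nonempty mK J2.
  by rewrite J0.
split.
  (* The full index set gives a function whose pole orders are exactly [b]. *)
  have [|h [h0 hR hb _]] := @nabla_nonempty [set: 'I_m]%SET mK; first by rewrite cardsT card_ord.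
  by exists h; split=> // k; rewrite hb ?inE // opprK.
apply/seteqP; split=> // c [[k _ ck] cH].
by have [h /nabla_single_empty] := mem_nabla_fun ck cH.
Qed.

End Criterion.

Lemma rel_maximal_single b i h : rel_maximal_elts Q b -> ~ nabla_fun [set i] b h.
Proof.
move=> [[_ b_max] _] /nabla_fun_mem[hb hH].
suff : nabla Q b [ffun k => - Q k h] by rewrite b_max.
by split=> //; exists i.
Qed.

Lemma exists_rel_maximal a i : (0 < genus X)%N -> (2 <= m <= #|K|)%N ->
  (forall f, RRspace (div_of Q a) f -> f != 0 -> Q i f <> - a i) ->
  exists2 b, rel_maximal_elts Q b & b i = a i /\ forall j, j != i -> a j < b j.
Proof.
move=> g_gt0 m2K a_gap.
pose above b := [/\ b i = a i, forall j, j != i -> a j < b j &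
  forall h, ~ nabla_fun [set i] b h].
(* The bound is the pole order at [Q j] of the function from [exact_pole]: if [b j] exceeded it,
   that function would witness an element of [nabla_i(b)]. *)
have /choice[B BP] j : exists B : int, forall b, above b -> b j <= B.
  have [->|ji] := eqVneq j i; first by exists (a i) => b [->].
  have ij : i != j by rewrite eq_sym.
  have [h [hR h0 hi hk]] := exact_pole g_gt0 Q_inj Q_rat a ij.
  exists (- Q j h) => b [bi ab b_i]; rewrite leNgt; apply/negP => hb.
  apply: (b_i h); split=> // k; rewrite inE; first by move=> /eqP ->; rewrite hi bi.
  move=> ki; have [->|kj] := eqVneq k j; first by lia.
  by have := hk k ki kj; have := ab k ki; lia.
(* Each raise by one uses up a unit of the room left below the sum of the bounds [B k]. *)
have climb n b : above b -> \sum_k B k - \sum_k b k < n%:Z -> exists2 b', above b' &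
    forall j, j != i -> exists h, nabla_fun [set i; j] b' h.
  elim: n b => [|n IH] b b_above B_b.
    by move: B_b; rewrite subr_lt0 ltNge => /negP[]; apply: ler_sum => k _; apply: BP.
  case: (pselect (forall j, j != i -> exists h, nabla_fun [set i; j] b h)).
    by exists b.
  move=> /existsNP[j /not_implyP[ji b_ij]].
  have [bi ab b_i] := b_above.
  apply: (IH (set_at b j (b j + 1))); last first.
    by move: B_b; rewrite sum_set_at; move: (\sum_k B k) (\sum_k b k) => x y; lia.
  split=> [|k ki|h].
  - by rewrite set_at_neq // eq_sym.
  - rewrite ffunE; case: eqVneq => [->|_]; last exact: ab.
    by have := ab j ji; lia.
  move=> [h0 hR hi hk].
  have {}hi : Q i h = - b i by rewrite hi ?inE // set_at_neq // eq_sym.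
  have hj : - b j <= Q j h by have := hk j; rewrite inE set_at_eq => /(_ ji); lia.
  have {}hk k : k != i -> k != j -> - b k < Q k h.
    by move=> ki kj; have := hk k; rewrite inE set_at_neq //; apply.
  (* A witness for the raised tuple has pole order at most [b j] at [Q j]: equality puts it in
     [nabla_{i,j}(b)], strict inequality in [nabla_i(b)], and both are empty. *)
  have [hj_eq|/eqP hj_neq] := eqVneq (Q j h) (- b j).
    apply: b_ij; exists h; split=> // k; rewrite !inE.
      by case/orP => /eqP ->.
    by rewrite negb_or => /andP[]; apply: hk.
  apply: (b_i h); split=> // k; rewrite inE; first by move=> /eqP ->.
  move=> ki; have [->|kj] := eqVneq k j; [lia | exact: hk].
(* Pole orders strictly below [a k + 1] are at most [a k], so a function in [nabla_i(b0)] would lie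
   in [L(D_a)], against [a_gap]. *)
pose b0 : {ffun 'I_m -> int} := [ffun k => if k == i then a i else a k + 1].
have b0_above : above b0.
  split=> [|j ji|h [h0 hR hi hk]]; rewrite ?ffunE ?eqxx ?(negPf ji) //; first by lia.
  apply: (a_gap h) => //; last by rewrite hi ?inE // ffunE eqxx.
  apply/RRspaceE => //; split=> // k; right; have [->|ki] := eqVneq k i.
    by rewrite hi ?inE // ffunE eqxx.
  by have := hk k; rewrite inE ffunE (negPf ki) => /(_ isT); lia.
pose d := \sum_k B k - \sum_k b0 k.
have [|b [bi ab b_i] b_ij] := climb (absz d).+1 b0 b0_above; first by rewrite -/d; lia.
by exists b => //; apply: rel_maximal_criterion b_i b_ij m2K.
Qed.

End Maximal.

(** * The description of the pure gaps *)

Theorem theorem3p2 (K : finFieldType) (X : curve K) (m : nat)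
    (Q : 'I_m -> place X)
    (genus_gt0 : (0 < genus X)%N)
    (m_ge2 : (2 <= m)%N)
    (Q_distinct : injective Q)
    (Q_rational : forall i, rational_point (Q i))
    (q_ge_m : (m <= #|K|)%N) :
  pure_gaps Q =
  \bigcup_(b in [set b : 'I_m -> {ffun 'I_m -> int} |
                  forall i, nneg_rel_maximal_elts Q (b i)])
    \bigcap_(i in [set: 'I_m]) nabla_bar [set i]%SET (b i).
Proof.
apply/seteqP; split=> a.
  move=> [[a_nneg _] a_ell].
  have /choice[b bP] i : exists b, [/\ rel_maximal_elts Q b, b i = a i &
      forall j, j != i -> a j < b j].
    have [|f fa f0 fi|b b_max []] :=
      @exists_rel_maximal K X m Q Q_distinct Q_rational a i genus_gt0.
    - by rewrite m_ge2.
    - have := a_ell i; rewrite div_of_sub // => aE.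
      have := ell_step genus_gt0 Q_distinct Q_rational fa f0 fi.
      by rewrite aE; lia.
    by exists b.
  exists b => /= i.
    have [b_max bi ab] := bP i; split=> // j.
    have [->|ji] := eqVneq j i; first by rewrite bi; apply: a_nneg.
    by have := a_nneg j; have := ab j ji; lia.
  move=> _; have [_ bi ab] := bP i; split=> j; rewrite inE; last exact: ab.
  by move=> /eqP ->; rewrite bi.
move=> [b /= b_max ab].
have {ab} [abi abj] : (forall i, a i = b i i) /\ (forall i j, j != i -> a j < b i j).
  by split=> [i|i j ji]; have [ab1 ab2] := ab i I;
    [apply: ab1; rewrite inE | apply: ab2; rewrite inE].
have a_nneg i : 0 <= a i by rewrite abi; have [_] := b_max i; apply.
have a_gap i f : RRspace (div_of Q a) f -> f != 0 -> Q i f <> - a i.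
  move=> /(RRspaceE Q_distinct)[fR fa] f0 fi; have [bi _] := b_max i.
  apply: (rel_maximal_single (i := i) (h := f) bi); split=> // k; rewrite inE.
    by move=> /eqP ->; rewrite fi abi.
  by move=> ki; have := fa k; have := abj i k ki; rewrite val_geE //; lia.
split; last first.
  move=> j; rewrite div_of_sub // /ell; congr (dim_mod _ _).
  apply/seteqP; split=> f; last first.
    by apply: RRspace_sub => // k; rewrite ffunE; case: eqVneq => // ->; lia.
  move=> fa; have [//|[f0 fj]] := RRspace_exact Q_distinct j fa.
  by case: (a_gap j f fa f0 fj).
(* A function with pole divisor [D_a] has exact pole order [a i] wherever [a i > 0], so [a_gap]
   forces [a = 0]; then the constant 1 contradicts [a_gap]. *)
split=> // -[_ [h [h0 h_poles]]].
have ha : RRspace (div_of Q a) h by right=> P; rewrite h_poles; lia.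
have a0 i : a i = 0.
  have := h_poles (Q i); rewrite coeff_div_of // => ahi.
  by have := a_gap i h ha h0; have := a_nneg i; lia.
have i0 : 'I_m by exists 0%N; lia.
apply: (a_gap i0 1); rewrite ?oner_eq0 ?pval1 ?a0 ?oppr0 //.
apply/RRspaceE => //; split=> [|i]; right; last by rewrite pval1 a0.
by move=> P _; rewrite pval1.
Qed.
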